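(* The P-IMPES scheme is unbiased with respect to the two phases, in the following sense. Let $S^{h,n}_w,S^{h,n}_n\in Q_h$ with $S^{h,n}_w+S^{h,n}_n=1$ be given, and let $p^{h,n+1}_{nw}\in Q_h$ and $\boldsymbol{\xi}^{h,n+1}_c\in\mathbf{U}_h$ be obtained from Step 1 of the algorithm in the context. (i) (Pressures.) Solving in Step 2 for $(p^{h,n+1}_w,\mathbf{u}^{h,n+1}_t)$ from equations (T) and (Dw) and then setting $p^{h,n+1}_n=p^{h,n+1}_{nw}+p^{h,n+1}_w$ is equivalent to solving for $(p^{h,n+1}_n,\mathbf{u}^{h,n+1}_t)$ from equations (T) and (Dn) and then setting $p^{h,n+1}_w=p^{h,n+1}_n-p^{h,n+1}_{nw}$. (ii) (Saturations.) With $\mathbf{u}^{h,n+1}_t$ satisfying (T), the following two ways of updating the saturations are equivalent: (a) compute $S^{h,n+1}_w$ from equation (M$_w$) and set $S^{h,n+1}_n=1-S^{h,n+1}_w$; (b) compute $S^{h,n+1}_w$ from equation (M$_w$) and $S^{h,n+1}_n$ from equation (M$_n$). In particular, (b) yields $S^{h,n+1}_w+S^{h,n+1}_n=1$, and (a) yields an $S^{h,n+1}_n$ that satisfies (M$_n$).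
   Context: **Model data.** Incompressible immiscible two-phase flow (wetting phase $w$, non-wetting phase $n$) in $\Omega\subset\mathbb{R}^d$, $d=2,3$, with boundary $\Gamma=\Gamma_D\cup\Gamma_N$ (disjoint), pressure data $p^B_\alpha$ on $\Gamma_D$, flux data $\mathbf{u}_\alpha\cdot\mathbf{n}=g^N_\alpha$ on $\Gamma_N$, and saturation data $S^B_\alpha$ on the inflow boundary $\Gamma_{\rm in}=\{\mathbf{x}\in\Gamma:\mathbf{u}_t\cdot\mathbf{n}<0\}$, where $\mathbf{u}_t=\mathbf{u}_w+\mathbf{u}_n$ is the total velocity. $\phi$ is the porosity (time-independent, uniformly bounded below and above by positive constants), $\mathbf{K}$ the symmetric positive definite absolute permeability tensor, $\rho_\alpha$ the densities, $g$ the gravitational acceleration, $z$ the depth, $F_\alpha$ the source/sink terms, $F_t=F_w+F_n$, $p_c$ the capillary pressure function, $\lambda_\alpha=\lambda_\alpha(S_w)\ge0$ the bounded phase mobilities, $\lambda_t=\lambda_w+\lambda_n>0$, $f_\alpha=\lambda_\alpha/\lambda_t$, so $f_w+f_n=1$. **Spaces.** $\mathcal{T}_h$ is a quasi-uniform simplicial mesh of $\Omega$. $\mathbf{U}_h=RT_0(\mathcal{T}_h)$ is the lowest-order Raviart–Thomas space, $\mathbf{U}^0_h=\{\mathbf{v}\in\mathbf{U}_h:\mathbf{v}\cdot\mathbf{n}=0\text{ on }\Gamma_N\}$, and $Q_h$ is the space of piecewise constants on $\mathcal{T}_h$ (so $\nabla\cdot\mathbf{v}\in Q_h$ for $\mathbf{v}\in\mathbf{U}_h$).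 $(\cdot,\cdot)$ is the $L^2(\Omega)$ inner product. **Upwind values and forms.** Let $\mathbf{u}^{h,n}_\alpha$ be the discrete velocity of phase $\alpha$ available at time step $n$, and $\{\cdot\}$ the average across an interior edge/face. On $\gamma=\partial K_i\cap\partial K_j$ with unit normal $\mathbf{n}_\gamma$ exterior to $K_i$, put $S^{\ast,h,n}_\alpha=S^{h,n}_\alpha|_{K_i}$ if $\{\mathbf{u}^{h,n}_\alpha\cdot\mathbf{n}_\gamma\}\ge0$ and $S^{\ast,h,n}_\alpha=S^{h,n}_\alpha|_{K_j}$ otherwise; then $S^{\ast,h,n}_{w,w}=S^{\ast,h,n}_w$, $S^{\ast,h,n}_{w,n}=1-S^{\ast,h,n}_n$. On $\gamma\subset\Gamma_{\rm in}$, $S^{\ast,h,n}_{w,\alpha}$ is the $L^2$-projection of $S^B_w$ onto constants on $\gamma$; on other boundary edges/faces it is the value $S^{h,n}_w$ of the adjacent element. For $\mathbf{v}\in\mathbf{U}_h$, $q\in Q_h$, $$B_\alpha(\mathbf{v},q;S^{h,n}_w)=\sum_{K\in\mathcal{T}_h}\int_{\partial K}f_\alpha(S^{\ast,h,n}_{w,\alpha})\,\mathbf{v}\cdot\mathbf{n}\,q,\qquad B_c(\mathbf{v},q;S^{h,n}_w)=\sum_{K\in\mathcal{T}_h}\int_{\partial K}f_n(S^{\ast,h,n}_{w,n})f_w(S^{\ast,h,n}_{w,w})\,\mathbf{v}\cdot\mathbf{n}\,q,$$ with $\mathbf{n}$ the unit outward normal to $\partial K$ and $q$ on $\partial K$ taken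 from inside $K$. **Equations** (for all $\mathbf{v}\in\mathbf{U}^0_h$, $q\in Q_h$; $\lambda_t,f_w,f_n$ in (Dw), (Dn), (C) are evaluated at $S^{h,n}_w$; $\sigma_w=1$, $\sigma_n=-1$): - (M$_\alpha$), $\alpha=w,n$: $\big(\phi\frac{S^{h,n+1}_\alpha-S^{h,n}_\alpha}{t_{n+1}-t_n},q\big)+B_\alpha(\mathbf{u}^{h,n+1}_t,q;S^{h,n}_w)=(F_\alpha,q)+\sigma_\alpha B_c(\boldsymbol{\xi}^{h,n+1}_c,q;S^{h,n}_w)$. - (T): $\sum_{\alpha=w,n}B_\alpha(\mathbf{u}^{h,n+1}_t,q;S^{h,n}_w)=(F_t,q)$. - (Dw): $((\lambda_t\mathbf{K})^{-1}\mathbf{u}^{h,n+1}_t,\mathbf{v})-(p^{h,n+1}_w,\nabla\cdot\mathbf{v})=((\lambda_t\mathbf{K})^{-1}f_n\boldsymbol{\xi}^{h,n+1}_c,\mathbf{v})-\int_{\Gamma_D}p^B_w\mathbf{v}\cdot\mathbf{n}-(\rho_wg\nabla z,\mathbf{v})$. - (Dn): $((\lambda_t\mathbf{K})^{-1}\mathbf{u}^{h,n+1}_t,\mathbf{v})-(p^{h,n+1}_n,\nabla\cdot\mathbf{v})=-((\lambda_t\mathbf{K})^{-1}f_w\boldsymbol{\xi}^{h,n+1}_c,\mathbf{v})-\int_{\Gamma_D}p^B_n\mathbf{v}\cdot\mathbf{n}-(\rho_ng\nabla z,\mathbf{v})$. - (P): $(p^{h,n+1}_{nw},q)=(p_c(S^{h,n}_w),q)$.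 - (C): $((\lambda_t\mathbf{K})^{-1}\boldsymbol{\xi}^{h,n+1}_c,\mathbf{v})=(p_c(S^{h,n}_w),\nabla\cdot\mathbf{v})-\int_{\Gamma_D}(p^B_n-p^B_w)\mathbf{v}\cdot\mathbf{n}-((\rho_n-\rho_w)g\nabla z,\mathbf{v})$. **P-IMPES algorithm.** Step 1: compute $p^{h,n+1}_{nw}\in Q_h$ from (P) and $\boldsymbol{\xi}^{h,n+1}_c\in\mathbf{U}_h$ from (C). Step 2: compute $p^{h,n+1}_w\in Q_h$ and $\mathbf{u}^{h,n+1}_t\in\mathbf{U}_h$ from (T) and (Dw), and set $p^{h,n+1}_n=p^{h,n+1}_{nw}+p^{h,n+1}_w$. Step 3: compute $S^{h,n+1}_w\in Q_h$ from (M$_w$), and set $S^{h,n+1}_n=1-S^{h,n+1}_w$. *)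

(* Defs.v *)
From HB Require Import structures.
From mathcomp Require Import all_boot all_order all_algebra.
From mathcomp Require Import all_classical all_reals all_analysis.

Set Implicit Arguments.
Unset Strict Implicit.
Unset Printing Implicit Defensive.

Import Order.TTheory GRing.Theory Num.Theory.
Import numFieldNormedType.Exports.

Local Open Scope classical_set_scope.
Local Open Scope ring_scope.

(* 'rV[R]_n carries the sigma-algebra generated by the coordinates, that is,
   the Borel sets. *)
Fact rV_display : measure_display.
Proof. exact: default_measure_display. Qed.

Section measurable_rV.
Context {R : realType} (n : nat).

Let coord (i : 'I_n) (x : 'rV[R]_n) : R := x 0 i.

Let rV_set0 : g_sigma_preimage coord set0.
Proof. exact: sigma_algebra0. Qed.

Let rV_setC A : g_sigma_preimage coord A -> g_sigma_preimage coord (~` A).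
Proof. exact: sigma_algebraC. Qed.

Let rV_bigcup (F : (set 'rV[R]_n)^nat) :
  (forall i, g_sigma_preimage coord (F i)) ->
  g_sigma_preimage coord (\bigcup_i (F i)).
Proof. exact: sigma_algebra_bigcup. Qed.

HB.instance Definition _ := @isMeasurable.Build rV_display
  'rV[R]_n (g_sigma_preimage coord) rV_set0 rV_setC rV_bigcup.

Lemma measurable_coord (i : 'I_n) :
  measurable_fun [set: 'rV[R]_n] (fun x : 'rV[R]_n => x 0 i).
Proof.
move=> _ Y mY; rewrite setTI; apply: sub_sigma_algebra => /=.
rewrite -bigcup_seq/=; exists i => /=; first by rewrite mem_index_enum.
by exists Y => //; rewrite setTI.
Qed.

Lemma measurable_fun_rVP d (T : measurableType d) (f : T -> 'rV[R]_n) :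
  (forall i, measurable_fun [set: T] (fun x => f x 0 i)) ->
  measurable_fun [set: T] f.
Proof.
move=> mf _ A mA; rewrite setTI.
suff : <<s \big[setU/set0]_(i < n) preimage_set_system setT (coord i) measurable >>
    `<=` [set A | measurable (f @^-1` A)] by exact.
apply: smallest_sub.
  split => /=.
  - by rewrite preimage_set0.
  - by move=> B mB; rewrite setTD preimage_setC; exact: measurableC.
  - by move=> F mF; rewrite preimage_bigcup; exact: bigcup_measurable.
move=> B; rewrite -bigcup_seq => -[i /= _ [Y mY <-]].
by rewrite setTI -[X in measurable X]setTI; exact: (mf i).
Qed.

End measurable_rV.


(* Lebesgue measure on R^n, by recursion on n: the point mass for n = 0 and,
   for n.+1, the product of the one-dimensional Lebesgue measure with the
   measure on R^n, transported along (t, x) |-> (t, x_0, ..., x_(n-1)) *)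
Section lebesgue_rV.
Context {R : realType}.

Definition rV_cons n (p : R * 'rV[R]_n) : 'rV[R]_n.+1 :=
  row_mx (const_mx p.1 : 'rV[R]_1) p.2.

Definition rV_uncons n (x : 'rV[R]_n.+1) : R * 'rV[R]_n :=
  (x 0 ord0, rsubmx (x : 'rV[R]_(1 + n))).

Lemma rV_consK n : cancel (@rV_cons n) (@rV_uncons n).
Proof.
case=> t x; rewrite /rV_uncons /rV_cons row_mxKr; congr pair => /=.
apply: etrans (etrans (row_mxEl (const_mx t : 'rV[R]_1) x 0 0) (mxE _ _ _ _)).
by congr (row_mx _ _ _ _); exact/val_inj.
Qed.

Lemma rV_unconsK n : cancel (@rV_uncons n) (@rV_cons n).
Proof.
move=> x; apply: etrans (@hsubmxK _ 1 1 n x); rewrite /rV_cons /rV_uncons/=.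
congr (row_mx _ _); apply/rowP => i; rewrite !mxE; congr (x _ _).
by apply/val_inj; rewrite /= ord1.
Qed.

Lemma measurable_rV_cons n : measurable_fun setT (@rV_cons n).
Proof.
apply: measurable_fun_rVP => i; case: (@split_ordP 1 n i) => j ->.
  apply: (eq_measurable_fun fst) => [p _|//].
  exact/esym/(etrans (row_mxEl _ _ _ _) (mxE _ _ _ _)).
apply: (eq_measurable_fun (fun p : R * 'rV[R]_n => p.2 0 j)) => [p _|].
  exact/esym/row_mxEr.
exact: (measurableT_comp (measurable_coord j)).
Qed.

Lemma measurable_rV_uncons n : measurable_fun setT (@rV_uncons n).
Proof.
apply: measurable_fun_pair; first exact: measurable_coord.
apply: measurable_fun_rVP => i; under eq_fun do rewrite mxE.
exact: measurable_coord.
Qed.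

Section step.
Variables (n : nat) (mu : {sigma_finite_measure set 'rV[R]_n -> \bar R}).

Definition lebesgue_rV_step : set 'rV[R]_n.+1 -> \bar R :=
  pushforward (@lebesgue_measure R \x mu)%E (@rV_cons n).

Let lebesgue_rV_step0 : lebesgue_rV_step set0 = 0%E.
Proof. by rewrite /lebesgue_rV_step /pushforward preimage_set0 measure0. Qed.

Let lebesgue_rV_step_ge0 A : (0 <= lebesgue_rV_step A)%E.
Proof. by rewrite /lebesgue_rV_step /pushforward measure_ge0. Qed.

Let lebesgue_rV_step_sigma_additive : semi_sigma_additive lebesgue_rV_step.
Proof.
exact: (@measure_semi_sigma_additive _ _ _
  (measure_function_pushforward__canonical__measure_function_Measure
    (@lebesgue_measure R \x mu)%E (measurable_rV_cons (n := n)))).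
Qed.

HB.instance Definition _ := isMeasure.Build _ _ _ lebesgue_rV_step
  lebesgue_rV_step0 lebesgue_rV_step_ge0 lebesgue_rV_step_sigma_additive.

Let lebesgue_rV_step_sigma_finite : sigma_finite setT lebesgue_rV_step.
Proof.
have /sigma_finiteP[F [TF ndF Foo]] := sigma_finiteT (@lebesgue_measure R).
have /sigma_finiteP[G [TG ndG Goo]] := sigma_finiteT mu.
exists (fun k => @rV_uncons n @^-1` (F k `*` G k)).
  rewrite -preimage_bigcup -[LHS](preimage_setT (@rV_uncons n)).
  congr (_ @^-1` _); apply/seteqP; split => // -[x y] _.
  have [k _ Fkx] : (\bigcup_k F k) x by rewrite -TF.
  have [l _ Gly] : (\bigcup_k G k) y by rewrite -TG.
  exists (maxn k l) => //; split => /=.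
  - by move: x Fkx; exact/subsetPset/ndF/leq_maxl.
  - by move: y Gly; exact/subsetPset/ndG/leq_maxr.
move=> k; have [mF Fkoo] := Foo k; have [mG Gkoo] := Goo k.
have mFG : measurable (F k `*` G k) by exact: measurableX.
split; first by rewrite -[X in measurable X]setTI; exact: measurable_rV_uncons.
rewrite /lebesgue_rV_step /pushforward -comp_preimage.
rewrite (_ : _ \o _ = id); last by apply/funext => p; exact: rV_consK.
by rewrite preimage_id product_measure1E// lte_mul_pinfty// ge0_fin_numE.
Qed.

HB.instance Definition _ := Measure_isSigmaFinite.Build _ _ _ lebesgue_rV_step
  lebesgue_rV_step_sigma_finite.

End step.

Definition dirac_rV0 : set 'rV[R]_0 -> \bar R := \d_(0 : 'rV[R]_0).
HB.instance Definition _ := SigmaFiniteMeasure.on dirac_rV0.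

Fixpoint lebesgue_rV n : {sigma_finite_measure set 'rV[R]_n -> \bar R} :=
  if n is m.+1 then lebesgue_rV_step (lebesgue_rV m) else dirac_rV0.

Lemma measurable_box n (a b : 'rV[R]_n) :
  measurable [set x : 'rV[R]_n | forall i, a 0 i <= x 0 i <= b 0 i].
Proof.
rewrite (_ : [set _ | _] =
    \bigcap_(i in [set: 'I_n]) ((fun x : 'rV[R]_n => x 0 i) @^-1` `[a 0 i, b 0 i])).
  apply: fin_bigcap_measurable => // i _.
  by rewrite -[X in measurable X]setTI; exact: measurable_coord.
by apply/seteqP; split => x /= xab i; [move=> _|]; rewrite /= ?in_itv/=;
  [exact: xab|have := xab i I; rewrite /= in_itv].
Qed.

Lemma lebesgue_rV_box n (a b : 'rV[R]_n) : (forall i, a 0 i <= b 0 i) ->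
  lebesgue_rV n [set x : 'rV[R]_n | forall i, a 0 i <= x 0 i <= b 0 i] =
  (\prod_(i < n) (b 0 i - a 0 i))%:E.
Proof.
elim: n a b => [|n IHn] a b ab.
  by rewrite big_ord0 /= /dirac_rV0 diracE mem_set// => -[].
pose a' := rsubmx (a : 'rV[R]_(1 + n)); pose b' := rsubmx (b : 'rV[R]_(1 + n)).
have cE t (x : 'rV[R]_n) i : rV_cons (t, x) 0 (lift ord0 i) = x 0 i.
  transitivity (rV_cons (t, x) 0 (rshift 1 i)); last exact: row_mxEr.
  by congr (rV_cons _ _ _); exact/val_inj.
have c0 t (x : 'rV[R]_n) : rV_cons (t, x) 0 ord0 = t.
  by have [] := rV_consK (t, x).
have subE (c : 'rV[R]_n.+1) i : rsubmx (c : 'rV[R]_(1 + n)) 0 i = c 0 (lift ord0 i).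
  by rewrite mxE; congr (c _ _); exact/val_inj.
transitivity ((@lebesgue_measure R \x lebesgue_rV n)%E (`[a 0 ord0, b 0 ord0] `*`
    [set x : 'rV[R]_n | forall i, a' 0 i <= x 0 i <= b' 0 i])).
  rewrite /= /lebesgue_rV_step /pushforward; congr (_ _).
  apply/seteqP; split => -[t x] /=.
    move=> abx; split; first by have := abx ord0; rewrite c0 in_itv.
    by move=> i; have := abx (lift ord0 i); rewrite cE /a' /b' !subE.
  rewrite in_itv/= => -[abt abx] i; case: (unliftP ord0 i) => [j|] ->.
    by have := abx j; rewrite cE /a' /b' !subE.
  by rewrite c0.
rewrite product_measure1E//; last exact: measurable_box.
rewrite IHn; last by move=> i; rewrite /a' /b' !subE.
have lab : @lebesgue_measure R `[a 0 ord0, b 0 ord0]%classic =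
    (b 0 ord0 - a 0 ord0)%:E.
  rewrite lebesgue_measure_itv/= lte_fin; case: ltP => // ba.
  by congr EFin; apply/esym/eqP; rewrite subr_eq0 eq_le ba ab.
transitivity ((b 0 ord0 - a 0 ord0)%:E * (\prod_(i < n) (b' 0 i - a' 0 i))%:E)%E.
  by congr (_ * _)%E; exact: lab.
rewrite -EFinM big_ord_recl; congr ((_ * _)%:E).
by apply: eq_bigr => i _; rewrite /a' /b' !subE.
Qed.

End lebesgue_rV.

(* The norm `|x| of the library on 'rV[R]_n is the sup norm, hence enorm. *)
Section vectors.
Context {R : realType} (n : nat).
Implicit Types x y : 'rV[R]_n.

Definition dot x y : R := \sum_i x 0 i * y 0 i.

Definition enorm x : R := Num.sqrt (dot x x).

(* A x, for a point x written as a row *)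
Definition mxapply (A : 'M[R]_n) x : 'rV[R]_n := (A *m x^T)^T.

Definition partial (i : 'I_n) (f : 'rV[R]_n -> R) x : R :=
  'D_(delta_mx 0 i : 'rV[R]_n) f x.

Definition grad (f : 'rV[R]_n -> R) x : 'rV[R]_n := \row_i partial i f x.

Definition divergence (v : 'rV[R]_n -> 'rV[R]_n) x : R :=
  \sum_i partial i (fun y => v y 0 i) x.

End vectors.

Section simplices.
Context {R : realType} (n : nat) (V : finType) (pos : V -> 'rV[R]_n).
Implicit Types (S : {set V}).

Definition simplex S : set 'rV[R]_n :=
  [set x | exists w : V -> R, [/\ forall v, v \in S -> 0 <= w v,
    \sum_(v in S) w v = 1 & x = \sum_(v in S) w v *: pos v]].

Definition relint S : set 'rV[R]_n :=
  [set x | exists w : V -> R, [/\ forall v, v \in S -> 0 < w v,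
    \sum_(v in S) w v = 1 & x = \sum_(v in S) w v *: pos v]].

Definition affinely_independent S : Prop :=
  forall w : V -> R, \sum_(v in S) w v = 0 ->
    \sum_(v in S) w v *: pos v = 0 -> forall v, v \in S -> w v = 0.

End simplices.

(* Conforming simplicial meshes of Omega in R^(d+1). The mesh also carries an
   orientation of its facets: among the (one or two) cells adjacent to the
   facet F, [owner F] is the one called K_i in the definition of the upwind
   values, from which the unit normal of F points outwards. *)
Record mesh (R : realType) (d : nat) (Omega : set 'rV[R]_d.+1) := Mesh {
  vertex : finType;
  pos : vertex -> 'rV[R]_d.+1;
  cell : finType;
  verts : cell -> {set vertex};
  verts_inj : injective verts;
  card_verts : forall K, #|verts K| = d.+2;
  verts_independent : forall K, affinely_independent pos (verts K);
  mesh_conforming : forall K K', simplex pos (verts K) `&` simplex pos (verts K')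
    = simplex pos (verts K :&: verts K');
  mesh_cover : Omega = (\bigcup_(K in [set: cell]) simplex pos (verts K))^°;
  owner : {set vertex} -> cell;
  owner_adjacent : forall (F : {set vertex}) K,
    F \subset verts K -> #|F| = d.+1 -> F \subset verts (owner F)
}.

Section mesh_theory.
Context {R : realType} {d : nat} {Omega : set 'rV[R]_d.+1} (M : mesh Omega).
Local Notation point := 'rV[R]_d.+1.
Implicit Types (K : cell M) (F : {set vertex M}) (x : point).

Definition cell_set K : set point := simplex (@pos R d Omega M) (verts K).
Definition facet_set F : set point := simplex (@pos R d Omega M) F.
Definition facet_relint F : set point := relint (@pos R d Omega M) F.

(* max_K diam K <= c * min_K (radius of a ball inscribed in K) *)
Definition quasi_uniform (c : R) : Prop := forall K K',
  exists (x : point) (r : R), [/\ 0 < r,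
    [set y | enorm (y - x) <= r] `<=` cell_set K &
    forall y z, cell_set K' y -> cell_set K' z -> enorm (y - z) <= c * r].

Definition facets K : {set {set vertex M}} :=
  [set F : {set vertex M} | (F \subset verts K) && (#|F| == d.+1)]%SET.

(* the cell on the other side of F, if any *)
Definition neighbor F : option (cell M) :=
  [pick K | (F \in facets K) && (K != owner F)].

Definition boundary_facet F : bool :=
  [exists K, F \in facets K] && (neighbor F == None).

(* unit normal of the facet F of K, exterior to K *)
Definition normal K F : point := xget 0 [set n | [/\ dot n n = 1,
  forall u v, u \in F -> v \in F -> dot n (pos u - pos v) = 0 &
  forall u v, u \in verts K -> u \notin F -> v \in F ->
    dot n (pos u - pos v) < 0]].

(* Surface integrals over F = conv(a_0, ..., a_d), through the parametrization
   t |-> a_0 + \sum_i t_i (a_(i+1) - a_0) of F by the unit simplex of R^d, with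
   area element sqrt(det(E E^T)) where E has rows a_(i+1) - a_0. *)
Definition unit_simplex : set 'rV[R]_d :=
  [set t | (forall i, 0 <= t 0 i) /\ \sum_i t 0 i <= 1].

Definition facet_vertex F (i : nat) : point := nth 0 [seq pos v | v <- enum F] i.

Definition facet_edges F : 'M[R]_(d, d.+1) :=
  \matrix_(i < d) (facet_vertex F i.+1 - facet_vertex F 0%N).

Definition facet_param F (t : 'rV[R]_d) : point :=
  facet_vertex F 0%N + t *m facet_edges F.

Definition facet_integral F (f : point -> R) : R :=
  Num.sqrt (\det (facet_edges F *m (facet_edges F)^T)) *
  \int[lebesgue_rV d]_(t in unit_simplex) f (facet_param F t).

Definition facet_integrable F (f : point -> R) : Prop :=
  (lebesgue_rV d).-integrable unit_simplex (fun t => (f (facet_param F t))%:E).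

(* L2(F)-projection of f onto the constants *)
Definition facet_proj F (f : point -> R) : R :=
  xget 0 [set c | forall q : R,
    facet_integral F (fun x => c * q) = facet_integral F (fun x => f x * q)].

Definition ip (f g : point -> R) : R :=
  \int[lebesgue_rV d.+1]_(x in Omega) (f x * g x).

Definition ipv (f g : point -> point) : R :=
  \int[lebesgue_rV d.+1]_(x in Omega) dot (f x) (g x).

Definition integrable_on (f : point -> R) : Prop :=
  (lebesgue_rV d.+1).-integrable Omega (EFin \o f).

(* Q_h: one value per cell. Elementwise fields: one field per cell, K |-> v_K,
   defined on the whole space but of which only the restriction to K matters. *)
Definition Qh : Type := cell M -> R.
Definition broken (A : Type) : Type := cell M -> point -> A.

(* An elementwise field as a function on Omega; on the skeleton of the mesh,
   a null set, the value is taken from one of the adjacent cells. *)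
Definition cell_at x : option (cell M) := [pick K | `[< cell_set K x >]].

Definition glue (A : nmodType) (f : broken A) x : A :=
  if cell_at x is Some K then f K x else 0.

Definition pwconst (q : Qh) : point -> R := glue (fun K _ => q K).

Definition glue_div (v : broken point) : point -> R :=
  glue (fun K => divergence (v K)).

(* RT_0: of the form a + b x on each cell, with continuous normal component
   across the interior facets *)
Definition RT0 (v : broken point) : Prop :=
  (forall K, exists (a : point) (b : R), forall x, v K x = a + b *: x) /\
  (forall K K' F, F \in facets K -> F \in facets K' ->
    forall x, facet_set F x ->
      dot (v K x) (normal K F) = dot (v K' x) (normal K F)).

End mesh_theory.

Arguments facet_integral {R d Omega} M F f.
Arguments facet_integrable {R d Omega} M F f.
Arguments facet_proj {R d Omega} M F f.
Arguments integrable_on {R d} Omega f.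
Arguments ip {R d} Omega f g.
Arguments ipv {R d} Omega f g.

Inductive phase := wet | nonwet.

(* The phase velocities u_alpha of the model enter only through their values on
   the boundary: u_alpha . n = gN alpha on GammaN, and the inflow boundary is
   where (u_wet + u_nonwet) . n < 0. The velocities of the discrete scheme are
   separate (the argument u below). *)
Record flow_data (R : realType) (n : nat) := FlowData {
  GammaD : set 'rV[R]_n;
  GammaN : set 'rV[R]_n;
  velocity : phase -> 'rV[R]_n -> 'rV[R]_n;
  pB : phase -> 'rV[R]_n -> R;
  gN : phase -> 'rV[R]_n -> R;
  SB : phase -> 'rV[R]_n -> R;
  porosity : 'rV[R]_n -> R;
  perm : 'rV[R]_n -> 'M[R]_n;
  density : phase -> R;
  gravity : R;
  depth : 'rV[R]_n -> R;
  source : phase -> 'rV[R]_n -> R;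
  pc : R -> R;
  mobility : phase -> R -> R
}.

Section scheme.
Context {R : realType} {d : nat} {Omega : set 'rV[R]_d.+1}.
Variables (M : mesh Omega) (D : flow_data R d.+1).
Local Notation point := 'rV[R]_d.+1.
Implicit Types (K : cell M) (F : {set vertex M}) (x : point) (a : phase).
Implicit Types (p q : Qh M) (v xi ut : broken M point).

Definition total_source x : R := source D wet x + source D nonwet x.

Definition total_mobility (s : R) : R := mobility D wet s + mobility D nonwet s.

Definition frac a (s : R) : R := mobility D a s / total_mobility s.

(* The mesh resolves the partition of the boundary: the relative interior of a
   boundary facet lies in GammaD or in GammaN. Relative interiors are used
   because a vertex may belong to facets of both kinds. *)
Definition dirichlet_facet F : bool :=
  boundary_facet F && `[< facet_relint F `<=` GammaD D >].

Definition neumann_facet F : bool :=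
  boundary_facet F && `[< facet_relint F `<=` GammaN D >].

Definition outer_normal F : point := normal (owner F) F.

Definition inflow_facet F : bool :=
  boundary_facet F && `[< forall x, facet_relint F x ->
    dot (velocity D wet x + velocity D nonwet x) (outer_normal F) < 0 >].

Record flow_data_ok : Prop := {
  boundary_cover : GammaD D `|` GammaN D = closure Omega `\` Omega;
  boundary_disjoint : GammaD D `&` GammaN D = set0;
  boundary_resolved : forall F, boundary_facet F ->
    dirichlet_facet F \/ neumann_facet F;
  neumann_flux : forall a F x, neumann_facet F -> facet_relint F x ->
    dot (velocity D a x) (outer_normal F) = gN D a x;
  pB_integrable : forall a F, dirichlet_facet F -> facet_integrable M F (pB D a);
  SB_integrable : forall a F, inflow_facet F -> facet_integrable M F (SB D a);
  porosity_measurable : measurable_fun Omega (porosity D);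
  porosity_bounds : exists c C : R, 0 < c /\
    forall x, Omega x -> c <= porosity D x <= C;
  perm_sym : forall x, Omega x -> (perm D x)^T = perm D x;
  perm_posdef : forall x, Omega x ->
    forall y, y != 0 -> 0 < dot (mxapply (perm D x) y) y;
  perm_inv_integrable : forall i j,
    integrable_on Omega (fun x => invmx (perm D x) i j);
  depth_differentiable : forall x, Omega x -> differentiable (depth D) x;
  depth_integrable : forall i, integrable_on Omega (partial i (depth D));
  source_integrable : forall a, integrable_on Omega (source D a);
  mobility_bounds : forall a, exists C : R, forall s, 0 <= mobility D a s <= C;
  total_mobility_gt0 : forall s, 0 < total_mobility s
}.

Definition RT0_0 v : Prop := RT0 v /\
  forall F x, neumann_facet F -> facet_set F x ->
    dot (v (owner F) x) (outer_normal F) = 0.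

Section time_step.
(* S and u are the saturations and phase velocities at t_n; the velocities are
   arbitrary elementwise fields, hence the averages in [upwind]. *)
Variables (tn tn1 : R) (S : phase -> Qh M) (u : phase -> broken M point).

(* S*_alpha on the interior facet F between owner F and K' *)
Definition upwind a F K' x : R :=
  let un K := dot (u a K x) (outer_normal F) in
  if 0 <= (un (owner F) + un K') / 2 then S a (owner F) else S a K'.

(* S*_(w,alpha) *)
Definition upwind_wet a F x : R :=
  if neighbor F is Some K' then
    match a with wet => upwind wet F K' x | nonwet => 1 - upwind nonwet F K' x end
  else if inflow_facet F then facet_proj M F (SB D wet)
  else S wet (owner F).

Definition B_form a v q : R := \sum_(K : cell M) \sum_(F in facets K)
  facet_integral M F (fun x =>
    frac a (upwind_wet a F x) * dot (v K x) (normal K F) * q K).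

Definition Bc_form v q : R := \sum_(K : cell M) \sum_(F in facets K)
  facet_integral M F (fun x =>
    frac nonwet (upwind_wet nonwet F x) * frac wet (upwind_wet wet F x) *
    dot (v K x) (normal K F) * q K).

Definition Sw_h : point -> R := pwconst (S wet).

(* (lambda_t K)^-1 *)
Definition resistance x : 'M[R]_d.+1 :=
  invmx (total_mobility (Sw_h x) *: perm D x).

(* ((lambda_t K)^-1 c w, v) *)
Definition resistance_form (c : point -> R) (w v : broken M point) : R :=
  ipv Omega (fun x => mxapply (resistance x) (c x *: glue w x)) (glue v).

Definition dirichlet_integral (g : point -> R) v : R :=
  \sum_(F : {set vertex M} | dirichlet_facet F)
    facet_integral M F (fun x => g x * dot (v (owner F) x) (outer_normal F)).

Definition gravity_form (rho : R) v : R :=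
  ipv Omega (fun x => (rho * gravity D) *: grad (depth D) x) (glue v).

Definition sign a : R := match a with wet => 1 | nonwet => -1 end.

Definition mass_eq a ut xi (S1 : Qh M) : Prop := forall q,
  ip Omega (fun x => porosity D x *
      ((pwconst S1 x - pwconst (S a) x) / (tn1 - tn))) (pwconst q)
    + B_form a ut q
  = ip Omega (source D a) (pwconst q) + sign a * Bc_form xi q.

Definition total_eq ut : Prop := forall q,
  B_form wet ut q + B_form nonwet ut q = ip Omega total_source (pwconst q).

Definition darcy_wet_eq xi p ut : Prop := forall v, RT0_0 v ->
  resistance_form (fun=> 1) ut v - ip Omega (pwconst p) (glue_div v)
  = resistance_form (fun x => frac nonwet (Sw_h x)) xi v
    - dirichlet_integral (pB D wet) v - gravity_form (density D wet) v.

Definition darcy_nonwet_eq xi p ut : Prop := forall v, RT0_0 v ->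
  resistance_form (fun=> 1) ut v - ip Omega (pwconst p) (glue_div v)
  = - resistance_form (fun x => frac wet (Sw_h x)) xi v
    - dirichlet_integral (pB D nonwet) v - gravity_form (density D nonwet) v.

Definition pnw_eq p : Prop := forall q,
  ip Omega (pwconst p) (pwconst q) = ip Omega (pc D \o Sw_h) (pwconst q).

Definition xi_eq xi : Prop := forall v, RT0_0 v ->
  resistance_form (fun=> 1) xi v
  = ip Omega (pc D \o Sw_h) (glue_div v)
    - dirichlet_integral (fun x => pB D nonwet x - pB D wet x) v
    - gravity_form (density D nonwet - density D wet) v.

End time_step.
End scheme.

(* Main.v *)
Require Import Defs.
From mathcomp Require Import all_boot all_order all_algebra.
From mathcomp Require Import all_classical all_reals all_analysis.
From mathcomp Require Import measurable_realfun.
From mathcomp Require Import ring lra.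

Set Implicit Arguments.
Unset Strict Implicit.
Unset Printing Implicit Defensive.

Import Order.TTheory GRing.Theory Num.Theory.
Import numFieldNormedType.Exports.
Local Open Scope classical_set_scope.
Local Open Scope ring_scope.

(** Both equivalences say that one phase equation can be exchanged for the
    other, because their combination is an identity that already holds.

    Pressures. Subtracting the equation that defines xi_c from the wetting Darcy
    equation gives the non-wetting one, by f_w + f_n = 1 and by linearity of the
    boundary and gravity terms in the data. The pressures match because the
    divergence of a Raviart-Thomas field is piecewise constant, so it may be
    used to test the projection p_nw of p_c(S_w) ([darcy_equiv]).

    Saturations. The sum of the two mass equations, combined with the total
    velocity equation, says exactly that the defect e = S_w + S_n - 1 at the new
    time satisfies (phi e / dt, q) = 0 for all q ([mass_nonwet_equiv]). If e = 0
    this holds trivially; conversely q = e gives e = 0 on each cell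
    ([mass_rate_eq0]).

    Everything else is measure theory that these linear manipulations need. The
    integral of a non-integrable or non-measurable function is a junk value, so
    splitting an integral requires measurability of the domain and of the cells
    and integrability of each term. Cells are described by inequalities between
    barycentric coordinates, which are affine functions ([simplexE]); the domain
    is open, hence Borel ([open_measurable_rV]); piecewise constants and
    Raviart-Thomas fields are bounded and measurable ([tame]); and normal
    components are constant on facets ([flux_facet_const]). For the last step on
    e = 0, the relative interior of each cell is a nonempty open part of the
    domain that meets no other cell ([cell_at_relint]), so it has positive
    measure. *)

(** * The Euclidean inner product *)

Section dot_product.
Context {R : realType} {n : nat}.
Implicit Types (x y z : 'rV[R]_n) (a : R).

Lemma dotDl x y z : dot (x + y) z = dot x z + dot y z.
Proof.
by rewrite -big_split; apply: eq_bigr => i _; rewrite mxE mulrDl.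
Qed.

Lemma dotZl a x y : dot (a *: x) y = a * dot x y.
Proof. by rewrite mulr_sumr; apply: eq_bigr => i _; rewrite mxE mulrA. Qed.

Lemma dotC x y : dot x y = dot y x.
Proof. by apply: eq_bigr => i _; rewrite mulrC. Qed.

Lemma dot0r x : dot x 0 = 0.
Proof. by apply: big1 => i _; rewrite mxE mulr0. Qed.

Lemma dot_continuous x : continuous (dot x).
Proof.
apply: continuous_big => [|i _ y]; first exact: add_continuous.
by apply: continuousM; [exact: cst_continuous|exact: coord_continuous].
Qed.

Lemma measurable_dot x : measurable_fun setT (dot x).
Proof.
apply: measurable_sum => i; apply: measurable_funM => //.
exact: measurable_coord.
Qed.

End dot_product.

(** * Open sets and Lebesgue measure *)

Section borel_sets.
Context {R : realType} {n : nat}.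
Implicit Types (O : set 'rV[R]_n) (x : 'rV[R]_n).

Definition box (a b : 'rV[R]_n) : set 'rV[R]_n :=
  [set x | forall i, a 0 i <= x 0 i <= b 0 i].

(** The norm of row vectors is the sup norm, so a ball is a cube; shrinking its
    sides to rational endpoints gives countably many boxes to choose from. *)
Lemma open_box O x : open O -> O x -> exists a b : 'rV[rat]_n,
  [/\ forall i, ratr (a 0 i) < x 0 i < ratr (b 0 i) &
      box (map_mx ratr a) (map_mx ratr b) `<=` O].
Proof.
move=> oO Ox; have /nbhs_ballP[e /= e0 xeO] := open_nbhs_nbhs (conj oO Ox).
have aP i : {q : rat | x 0 i - e < ratr q < x 0 i}.
  by apply/cid; have [|q] := @rat_in_itvoo R (x 0 i - e) (x 0 i);
     [rewrite ltrBlDr ltrDl|rewrite in_itv/=; exists q].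
have bP i : {q : rat | x 0 i < ratr q < x 0 i + e}.
  by apply/cid; have [|q] := @rat_in_itvoo R (x 0 i) (x 0 i + e);
     [rewrite ltrDl|rewrite in_itv/=; exists q].
exists (\row_i sval (aP i)), (\row_i sval (bP i)); split => [i|y ybox].
  rewrite !mxE; case: (aP i) => qa /= /andP[_ ->].
  by case: (bP i) => qb /= /andP[->].
apply: xeO; split => // i j; have {i}-> : i = 0 by exact: ord1.
have := ybox j; rewrite !mxE; case: (aP j) => qa /= /andP[qa1 _].
case: (bP j) => qb /= /andP[_ qb2] /andP[ay yb].
rewrite /ball/= ltr_distlC; apply/andP; split.
  exact: lt_le_trans ay.
exact: le_lt_trans qb2.
Qed.

(** An open set is the union of the countably many closed rational boxes that
    it contains. *)
Lemma open_measurable_rV O : open O -> measurable O.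
Proof.
move=> oO.
pose F (p : 'rV[rat]_n * 'rV[rat]_n) : set 'rV[R]_n :=
  if `[< box (map_mx ratr p.1) (map_mx ratr p.2) `<=` O >]
  then box (map_mx ratr p.1) (map_mx ratr p.2) else set0.
suff -> : O = \bigcup_p F p.
  apply: countable_bigcupT_measurable => [|p]; first exact: countableP.
  by rewrite /F; case: ifP => // _; exact: measurable_box.
apply/seteqP; split => [x Ox|x [p _]].
  have [a [b [xab abO]]] := open_box oO Ox.
  exists (a, b) => //; rewrite /F/= asboolT// => i.
  by rewrite !mxE; have /andP[/ltW -> /ltW ->] := xab i.
by rewrite /F; case: asboolP => // pO /pO.
Qed.

(** A nonempty open set contains a box with nonempty interior, whose measure is
    the product of the side lengths. *)
Lemma open_lebesgue_gt0 O x : open O -> O x -> (0 < lebesgue_rV n O)%E.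
Proof.
move=> oO Ox; have [a [b [xab abO]]] := open_box oO Ox.
apply: (@lt_le_trans _ _ (lebesgue_rV n (box (map_mx ratr a) (map_mx ratr b)))).
  rewrite lebesgue_rV_box => [|i].
    rewrite lte_fin; apply: prodr_gt0 => i _; rewrite !mxE subr_gt0.
    by have /andP[] := xab i; exact: lt_trans.
  by rewrite !mxE; have /andP[/ltW + /ltW] := xab i; exact: le_trans.
apply: le_measure => //; rewrite inE; first exact: measurable_box.
exact: open_measurable_rV.
Qed.

End borel_sets.

(** * Barycentric coordinates *)

Section barycentric.
Context {R : realType} {n : nat} {V : finType}.
Variables (pos : V -> 'rV[R]_n) (S : {set V}).
Hypotheses (Sind : affinely_independent pos S) (cardS : #|S| = n.+1).

(** Stack the rows (1, pos v) into a square matrix P. Affine independence says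
    that P has trivial left kernel, so P has a left inverse Q, and the row
    (1, x) Q lists the barycentric coordinates of x, which are thus affine
    in x. *)
Lemma barycentric_exists : exists bary : V -> 'rV[R]_n -> R, [/\
  forall v, exists a b, bary v = fun x => dot a x + b,
  forall x, \sum_(v in S) bary v x = 1 &
  forall x, \sum_(v in S) bary v x *: pos v = x].
Proof.
pose P : 'M[R]_(#|S|, 1 + n) :=
  \matrix_i row_mx (const_mx 1 : 'rV_1) (pos (enum_val i)).
have /card_gt0P[v0 v0S] : (0 < #|S|)%N by rewrite cardS.
pose rk v := enum_rank_in v0S v.
have rowP_ i : row i P = row_mx (const_mx 1) (pos (enum_val i)) by rewrite rowK.
have mulP (w : 'rV_#|S|) : w *m P = row_mx
    (const_mx (\sum_(v in S) w 0 (rk v))) (\sum_(v in S) w 0 (rk v) *: pos v).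
  rewrite mulmx_sum_row (big_enum_val (fun v => w 0 (rk v)))/=.
  rewrite (big_enum_val (fun v => w 0 (rk v) *: pos v))/=.
  under eq_bigr do rewrite rowP_ scale_row_mx.
  have -> : const_mx (\sum_(i < #|S|) w 0 (rk (enum_val i))) =
      \sum_(i < #|S|) (w 0 i *: const_mx 1) :> 'rV[R]_1.
    apply/rowP => j; rewrite mxE summxE; apply: eq_bigr => i _.
    by rewrite !mxE mulr1 /rk enum_valK_in.
  under [X in row_mx _ X]eq_bigr do rewrite /rk enum_valK_in.
  by elim/big_rec3 : _ => [|i x y z _ ->]; rewrite ?row_mx0 ?add_row_mx.
have /row_fullP[Q QP] : row_full P.
  suff /eqP rkP : row_free P by rewrite /row_full rkP cardS.
  apply: inj_row_free => w /eqP; rewrite mulP -row_mx0.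
  move=> /eqP/eq_row_mx[/rowP/(_ 0)]; rewrite !mxE => w0 wpos0.
  apply/rowP => i; rewrite mxE -(enum_valK_in v0S i).
  by apply: (Sind w0 wpos0); exact: enum_valP.
pose w (x : 'rV[R]_n) := row_mx (const_mx 1 : 'rV_1) x *m Q.
have wP x : w x *m P = row_mx (const_mx 1) x by rewrite -mulmxA QP mulmx1.
exists (fun v x => w x 0 (rk v)); split=> [v|x|x].
- exists (\row_j Q (rshift 1 j) (rk v)), (Q (lshift n 0) (rk v)).
  apply/funext => x; rewrite /w mxE big_split_ord/= big_ord1 row_mxEl mxE mul1r.
  rewrite addrC; congr (_ + _); apply: eq_bigr => j _.
  by rewrite row_mxEr !mxE mulrC.
- by have := wP x; rewrite mulP => /eq_row_mx[/rowP/(_ 0)]; rewrite !mxE.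
- by have := wP x; rewrite mulP => /eq_row_mx[].
Qed.

Definition bary : V -> 'rV[R]_n -> R := sval (cid barycentric_exists).

Lemma bary_affine v : exists a b, bary v = fun x => dot a x + b.
Proof. by rewrite /bary; case: cid => ? [/= + _ _]; exact. Qed.

Lemma sum_bary x : \sum_(v in S) bary v x = 1.
Proof. by rewrite /bary; case: cid => ? [/= _ + _]; exact. Qed.

Lemma sum_bary_pos x : \sum_(v in S) bary v x *: pos v = x.
Proof. by rewrite /bary; case: cid => ? [/= _ _]; exact. Qed.

(** The difference of two systems of weights is an affine dependency. *)
Lemma bary_unique (w : V -> R) x : \sum_(v in S) w v = 1 ->
  x = \sum_(v in S) w v *: pos v -> forall v, v \in S -> w v = bary v x.
Proof.
move=> w1 xw v vS; apply/eqP; rewrite -subr_eq0; apply/eqP.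
apply: (@Sind (fun v => w v - bary v x)) vS => [|].
  by rewrite sumrB w1 sum_bary subrr.
under eq_bigr do rewrite scalerBl.
by rewrite sumrB sum_bary_pos -xw subrr.
Qed.

Lemma bary_continuous v : continuous (bary v).
Proof.
have [a [b ->]] := bary_affine v => x.
by apply: continuousD; [exact: dot_continuous|exact: cst_continuous].
Qed.

(** This and the next lemma trade the existential over weights for finitely many
    inequalities between affine functions, from which measurability, and
    openness of the relative interior, follow. *)
Lemma simplexE : simplex pos S =
  \bigcap_(v in [set` S]) (bary v @^-1` [set y | 0 <= y]).
Proof.
apply/seteqP; split => x.
  by move=> [w [w0 w1 xw]] v vS /=; rewrite -(bary_unique w1 xw vS); exact: w0.
move=> bx; exists (bary^~ x); split; [exact: bx|exact: sum_bary|].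
by rewrite sum_bary_pos.
Qed.

Lemma relintE : relint pos S =
  \bigcap_(v in [set` S]) (bary v @^-1` [set y | 0 < y]).
Proof.
apply/seteqP; split => x.
  by move=> [w [w0 w1 xw]] v vS /=; rewrite -(bary_unique w1 xw vS); exact: w0.
move=> bx; exists (bary^~ x); split; [exact: bx|exact: sum_bary|].
by rewrite sum_bary_pos.
Qed.

Lemma measurable_simplex : measurable (simplex pos S).
Proof.
rewrite simplexE; apply: fin_bigcap_measurable => // v _.
rewrite -[X in measurable X]setTI.
have /(_ measurableT) mb : measurable_fun setT (bary v).
  by have [a [b ->]] := bary_affine v; apply: measurable_funD;
    [exact: measurable_dot|exact: measurable_cst].
have -> : [set y : R | 0 <= y] = `[0, +oo[%classic.
  by apply/seteqP; split => y /=; rewrite in_itv/= andbT.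
exact: mb.
Qed.

Lemma open_relint : open (relint pos S).
Proof.
rewrite relintE openE => x bx.
suff : \forall y \near x, forall v, v \in S -> 0 < bary v y by [].
apply: (@filter_forall _ _ (fun v y => v \in S -> 0 < bary v y) _
  (nbhs_filter x)) => v.
have [vS|/negPf vS] := boolP (v \in S); last first.
  by apply: (@filterS _ _ (nbhs_filter x) setT) => //; exact: filterT.
have : open (bary v @^-1` [set y | 0 < y]).
  apply: open_comp => [z _|]; first exact: bary_continuous.
  exact: open_gt.
rewrite openE => /(_ x (bx v vS)); apply: filterS => y by0 _; exact: by0.
Qed.

(** The barycenter of the vertices is a relative interior point. *)
Lemma relint_neq0 : relint pos S !=set0.
Proof.
exists (\sum_(v in S) (n.+1%:R^-1 : R) *: pos v), (fun=> n.+1%:R^-1); split => //.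
by rewrite sumr_const cardS -[_ *+ _]mulr_natr mulVf.
Qed.

End barycentric.

Section simplex_bounds.
Context {R : realType} {n : nat} {V : finType} (pos : V -> 'rV[R]_n).

Lemma relint_sub_simplex (S : {set V}) : relint pos S `<=` simplex pos S.
Proof. by move=> x [w [w0 w1 xw]]; exists w; split=> // v /w0/ltW. Qed.

Lemma simplex_bounded : exists C : R, forall (S : {set V}) x i,
  simplex pos S x -> `|x 0 i| <= C.
Proof.
pose C := \sum_v \sum_i `|pos v 0 i|; exists C => S x i [w [w0 w1 ->]].
rewrite summxE (le_trans (ler_norm_sum _ _ _))// -[C]mul1r -w1 mulr_suml.
apply: ler_sum => v vS; rewrite mxE normrM ger0_norm ?w0// ler_wpM2l ?w0//.
rewrite /C (bigD1 v)//= (bigD1 i)//= -addrA lerDl addr_ge0//.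
  exact: sumr_ge0.
by apply: sumr_ge0 => *; exact: sumr_ge0.
Qed.

End simplex_bounds.

(** * Bounded measurable functions on a meshed domain *)

Section tame_functions.
Context {R : realType} {d : nat} {Omega : set 'rV[R]_d.+1} (M : mesh Omega).
Local Notation point := 'rV[R]_d.+1.
Local Notation mu := (lebesgue_rV d.+1).
Implicit Types (f g : point -> R) (x : point) (K : cell M).

Lemma open_domain : open Omega.
Proof. by rewrite (mesh_cover M); exact: open_interior. Qed.

Lemma measurable_domain : measurable Omega.
Proof. by apply: open_measurable_rV; exact: open_domain. Qed.

Lemma domain_covered x : Omega x -> exists K, cell_set K x.
Proof.
rewrite {1}(mesh_cover M) => /interior_subset[K _ xK].
by exists K.
Qed.

Lemma domain_bounded : exists C : R, forall x i, Omega x -> `|x 0 i| <= C.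
Proof.
have [C CP] := simplex_bounded (@pos _ _ _ M); exists C => x i.
by move=> /domain_covered[K /CP].
Qed.

Lemma domain_finite : (mu Omega < +oo)%E.
Proof.
have [C CP] := domain_bounded.
pose B := box (const_mx (- `|C|) : point) (const_mx `|C|).
apply: (@le_lt_trans _ _ (mu B)); last first.
  rewrite /B lebesgue_rV_box ?ltry// => i.
  by rewrite !mxE (le_trans _ (normr_ge0 C))// oppr_le0.
apply: le_measure; rewrite ?inE; [exact: measurable_domain|exact: measurable_box|].
move=> x /CP xC i; rewrite !mxE -ler_norml.
exact: le_trans (xC i) (ler_norm C).
Qed.

(** Bounded measurable functions form an algebra that contains the piecewise
    constants and the elementwise affine fields. They are integrable because the
    domain has finite measure, and their products with integrable data are
    integrable; every volume integral of the scheme that has to be split falls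
    in one of these two cases. *)
Definition tame f := measurable_fun Omega f /\
  exists C, forall x, Omega x -> `|f x| <= C.

Lemma tame_cst (c : R) : tame (fun=> c).
Proof. by split; [exact: measurable_cst|exists `|c|]. Qed.

Lemma tameD f g : tame f -> tame g -> tame (fun x => f x + g x).
Proof.
move=> [mf [C fC]] [mg [D gD]]; split; first exact: measurable_funD.
exists (C + D) => x Ox; rewrite (le_trans (ler_normD _ _))// lerD//.
  exact: fC.
exact: gD.
Qed.

Lemma tameM f g : tame f -> tame g -> tame (fun x => f x * g x).
Proof.
move=> [mf [C fC]] [mg [D gD]]; split; first exact: measurable_funM.
by exists (C * D) => x Ox; rewrite normrM ler_pM// ?fC ?gD.
Qed.

Lemma tame_sum (I : Type) (s : seq I) (F : I -> point -> R) :
  (forall i, tame (F i)) -> tame (fun x => \sum_(i <- s) F i x).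
Proof.
move=> tF; split; first by apply: measurable_sum => i; have [] := tF i.
elim: s => [|i s [C IH]].
  by exists 0 => x _; rewrite big_nil normr0.
have [_ [D iD]] := tF i; exists (D + C) => x Ox.
by rewrite big_cons (le_trans (ler_normD _ _))// lerD ?iD ?IH.
Qed.

Lemma tame_coord i : tame (fun x => x 0 i).
Proof.
split; last by have [C CP] := domain_bounded; exists C => x; exact: CP.
by apply: (measurable_funS measurableT) => //; exact: measurable_coord.
Qed.

Lemma tame_bounded f : tame f -> [bounded f x | x in Omega].
Proof.
move=> [_ [C fC]]; exists C; split => [|N CN x Ox]; first exact: num_real.
by rewrite /= (le_trans (fC x Ox))// ltW.
Qed.

Lemma tame_integrable f : tame f -> integrable_on Omega f.
Proof.
move=> tf; apply: measurable_bounded_integrable.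
- exact: measurable_domain.
- exact: domain_finite.
- by case: tf.
- exact: tame_bounded.
Qed.

Lemma integrable_tameM f g : integrable_on Omega f -> tame g ->
  integrable_on Omega (fun x => f x * g x).
Proof.
move=> fi tg; apply: (integrableMl measurable_domain fi); first by case: tg.
exact: tame_bounded.
Qed.

Lemma integrable_on_sum (I : Type) (s : seq I) (F : I -> point -> R) :
  (forall i, integrable_on Omega (F i)) ->
  integrable_on Omega (fun x => \sum_(i <- s) F i x).
Proof.
move=> Fi; rewrite /integrable_on (_ : _ \o _ = fun x => (\sum_(i <- s) (F i x)%:E)%E).
  by apply: (integrable_sum measurable_domain) => i _; exact: Fi.
by apply/funext => x /=; rewrite sumEFin.
Qed.

Lemma measurable_cell_set K : measurable (cell_set K).
Proof.
exact: measurable_simplex (@verts_independent _ _ _ M K) (card_verts K).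
Qed.

(** [cell_at M x] is the first cell, in the enumeration of cells, that contains
    [x]; so it is a function of the finite set of cells that contain [x], and
    each value of this set is attained on a Boolean combination of simplices. *)
Lemma measurable_cell_at (o : option (cell M)) :
  measurable [set x | cell_at M x = o].
Proof.
pose cells x := [set K : cell M | `[< cell_set K x >]]%SET.
have cell_atE x : cell_at M x = [pick K in cells x].
  by apply: eq_pick => K; rewrite inE.
have -> : [set x | cell_at M x = o] =
    \bigcup_(B in [set B : {set cell M} | [pick K in B] = o]) [set x | cells x = B].
  apply/seteqP; split => x /=; rewrite ?cell_atE.
    by move=> xo; exists (cells x).
  by move=> [B <- <-].
apply: fin_bigcup_measurable => // B _.
have -> : [set x | cells x = B] = \bigcap_(K in [set: cell M])
    (if K \in B then cell_set K else ~` cell_set K).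
  apply/seteqP; split => x /=.
    by move=> <- K _; rewrite inE; case: asboolP.
  move=> xB; apply/setP => K; have := xB K I.
  by rewrite inE; case: ifP => _; case: asboolP.
apply: fin_bigcap_measurable => // K _; case: ifP => _.
  exact: measurable_cell_set.
by apply: measurableC; exact: measurable_cell_set.
Qed.

(** Every function of the cell index is a combination of finitely many
    indicators; this covers piecewise constants and nonlinear functions of them
    such as mobilities of saturations. *)
Lemma tame_cell_at (G : option (cell M) -> R) : tame (fun x => G (cell_at M x)).
Proof.
have -> : (fun x => G (cell_at M x)) =
    fun x => \sum_(o : option (cell M)) G o * \1_[set y | cell_at M y = o] x.
  apply/funext => x; rewrite (bigD1 (cell_at M x))//= big1 => [|o /negPf xo].
    by rewrite addr0 indicE mem_set// mulr1.
  by rewrite indicE memNset ?mulr0// => /= xo'; rewrite xo' eqxx in xo.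
apply: tame_sum => o; apply: tameM; first exact: tame_cst.
split.
  apply: (measurable_funS measurableT) => //.
  exact: measurable_indic (measurable_cell_at o).
by exists 1 => x _; rewrite indicE; case: (_ \in _); rewrite ?normr1 ?normr0.
Qed.

Lemma tame_pwconst (q : Qh M) : tame (pwconst q).
Proof. exact: (tame_cell_at (fun o => if o is Some K then q K else 0)). Qed.

(** On the cell K the field is x |-> a_K + b_K x, hence globally it is a sum of
    products of piecewise constants and coordinates. *)
Lemma tame_glue_affine (v : broken M point) i :
  (forall K, exists (a : point) (b : R), forall x, v K x = a + b *: x) ->
  tame (fun x => Defs.glue v x 0 i).
Proof.
move=> /choice[a /choice[b vE]].
have -> : (fun x => Defs.glue v x 0 i) = fun x =>
    pwconst (fun K => a K 0 i) x + pwconst b x * x 0 i.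
  apply/funext => x; rewrite /pwconst /Defs.glue; case: cell_at => [K|].
    by rewrite vE !mxE.
  by rewrite mxE mul0r addr0.
apply: tameD; first exact: tame_pwconst.
by apply: tameM; [exact: tame_pwconst|exact: tame_coord].
Qed.

End tame_functions.

(** * Linearity of the volume forms, and divergences *)

Section bilinearity.
Context {R : realType} {d : nat} {Omega : set 'rV[R]_d.+1} (M : mesh Omega).
Local Notation point := 'rV[R]_d.+1.
Implicit Types (f g h : point -> R) (x : point) (K : cell M) (p q : Qh M).
Implicit Types (u w t : point -> point) (v : broken M point).

Lemma ip_eq f g h k : (forall x, Omega x -> f x * h x = g x * k x) ->
  ip Omega f h = ip Omega g k.
Proof. by move=> fg; apply: eq_Rintegral => x; rewrite inE; exact: fg. Qed.

Lemma ipDl f g h : integrable_on Omega f -> integrable_on Omega g ->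
  tame (Omega := Omega) h ->
  ip Omega (fun x => f x + g x) h = ip Omega f h + ip Omega g h.
Proof.
move=> fi gi th; rewrite /ip -RintegralD; first last.
- exact: (integrable_tameM M).
- exact: (integrable_tameM M).
- exact: (measurable_domain M).
by apply: eq_Rintegral => x _; rewrite mulrDl.
Qed.

Lemma ipvDl u w t : (forall i, integrable_on Omega (fun x => u x 0 i)) ->
  (forall i, integrable_on Omega (fun x => w x 0 i)) ->
  (forall i, tame (Omega := Omega) (fun x => t x 0 i)) ->
  ipv Omega (fun x => u x + w x) t = ipv Omega u t + ipv Omega w t.
Proof.
move=> ui wi ti; rewrite /ipv -RintegralD; first last.
- by apply: (integrable_on_sum M) => i; exact: (integrable_tameM M).
- by apply: (integrable_on_sum M) => i; exact: (integrable_tameM M).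
- exact: (measurable_domain M).
by apply: eq_Rintegral => x _; rewrite dotDl.
Qed.

Lemma pwconstD p q :
  pwconst (fun K => p K + q K) = fun x => pwconst p x + pwconst q x.
Proof.
by apply/funext => x; rewrite /pwconst /Defs.glue; case: cell_at; rewrite ?addr0.
Qed.

(** Divergences of Raviart-Thomas fields are admissible test functions in Q_h:
    the difference quotient of an affine field does not depend on the base
    point. *)
Lemma glue_div_pwconst v :
  (forall K, exists (a : point) (b : R), forall x, v K x = a + b *: x) ->
  exists q, glue_div v = pwconst q.
Proof.
move=> vaff; exists (fun K => divergence (v K) 0).
apply/funext => x; rewrite /glue_div /pwconst /Defs.glue.
case: cell_at => // K; have [a [b vE]] := vaff K.
apply: eq_bigr => i _; rewrite /partial /derive.
have quotE (y : point) : (fun e : R => e^-1 *: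
      (((fun z => v K z 0 i) \o shift y) (e *: delta_mx 0 i) - v K y 0 i)) =
    (fun e : R => e^-1 *: (b * e)).
  by apply/funext => e /=; rewrite !vE !mxE !eqxx /=; congr (_ *: _); ring.
by rewrite !quotE.
Qed.

End bilinearity.

(** * Surface integrals against normal components *)

Section facets.
Context {R : realType} {d : nat} {Omega : set 'rV[R]_d.+1} (M : mesh Omega).
Local Notation point := 'rV[R]_d.+1.
Implicit Types (f g h : point -> R) (F : {set vertex M}).

Lemma measurable_unit_simplex : measurable (@unit_simplex R d).
Proof.
have -> : @unit_simplex R d =
    (\bigcap_(i in [set: 'I_d]) ((fun x : 'rV[R]_d => x 0 i) @^-1` `[0, +oo[)) `&`
    (dot (const_mx 1) @^-1` `]-oo, 1]).
  have sumE (t : 'rV[R]_d) : \sum_i t 0 i = dot (const_mx 1) t.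
    by apply: eq_bigr => i _; rewrite mxE mul1r.
  apply/seteqP; split => t /=; rewrite /unit_simplex/= in_itv/= sumE.
    by move=> [t0 ->]; split=> // i _; rewrite /= in_itv/= andbT.
  by move=> [t0 ->]; split=> // i; have := t0 i I; rewrite /= in_itv/= andbT.
apply: measurableI.
  apply: fin_bigcap_measurable => // i _; rewrite -[X in measurable X]setTI.
  by apply: measurable_coord.
by rewrite -[X in measurable X]setTI; apply: measurable_dot.
Qed.

(** In the degenerate case where no unit normal exists, [normal K F] is the
    default value 0, which is orthogonal as well. *)
Lemma normal_orthogonal K F (u v : vertex M) : u \in F -> v \in F ->
  dot (normal K F) (pos u - pos v) = 0.
Proof.
move=> uF vF; rewrite /normal; case: xgetP => [n _ [_ nF _]|_].
  exact: nF.
by rewrite dotC dot0r.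
Qed.

Lemma facet_vertexP F i : (i < #|F|)%N ->
  exists2 u, u \in F & facet_vertex F i = pos u.
Proof.
rewrite cardE => iF; have /card_gt0P[u0 _] : (0 < #|F|)%N.
  by rewrite cardE (leq_ltn_trans _ iF).
exists (nth u0 (enum F) i); first by rewrite -mem_enum mem_nth.
by rewrite /facet_vertex (nth_map u0).
Qed.

(** The normal component of a + b x is constant on a facet, because the edges
    of the facet are orthogonal to its normal. *)
Lemma flux_facet_const K F (v : broken M point) K' (a : point) (b : R) t :
  #|F| = d.+1 -> (forall x, v K' x = a + b *: x) ->
  dot (v K' (facet_param F t)) (normal K F) =
  dot (v K' (facet_vertex F 0)) (normal K F).
Proof.
move=> cF vE; rewrite !vE /facet_param scalerDr addrA [LHS]dotDl dotZl mulmx_sum_row.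
rewrite [X in _ + _ * X](_ : _ = 0) ?mulr0 ?addr0// dotC.
elim/big_ind : _ => [|x y x0 y0|i _]; first exact: dot0r.
  by rewrite dotC dotDl dotC x0 dotC y0 addr0.
rewrite dotC dotZl rowK dotC.
have [|u uF ->] := @facet_vertexP F i.+1; first by rewrite cF ltnS.
have [|w wF ->] := @facet_vertexP F 0; first by rewrite cF.
by rewrite normal_orthogonal ?mulr0.
Qed.

(** As [h] is constant along the parametrization, integrability of [f] and [g]
    on the facet suffices to split the integral. *)
Lemma facet_integralB F f g h (c : R) :
  facet_integrable M F f -> facet_integrable M F g ->
  (forall t, h (facet_param F t) = c) ->
  facet_integral M F (fun x => (f x - g x) * h x) =
  facet_integral M F (fun x => f x * h x) - facet_integral M F (fun x => g x * h x).
Proof.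
move=> fi gi hc; rewrite /facet_integral -mulrBr; congr (_ * _).
under eq_Rintegral do rewrite hc.
under [in RHS]eq_Rintegral do rewrite hc.
under [X in _ - X]eq_Rintegral do rewrite hc.
rewrite !RintegralZr//; try exact: measurable_unit_simplex.
  by rewrite RintegralB//; [rewrite mulrBl|exact: measurable_unit_simplex].
exact: (integrableB measurable_unit_simplex fi gi).
Qed.

End facets.

(** * The two pressure equations *)

Section darcy.
Context {R : realType} {d : nat} {Omega : set 'rV[R]_d.+1}.
Variables (M : mesh Omega) (D : flow_data R d.+1) (hD : flow_data_ok M D).
Variable S : phase -> Qh M.
Local Notation point := 'rV[R]_d.+1.
Implicit Types (v xi : broken M point).

Lemma facet_card (F : {set vertex M}) : boundary_facet F -> #|F| = d.+1.
Proof.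
by move=> /andP[/existsP[K]]; rewrite inE => /andP[_ /eqP].
Qed.

Lemma dirichlet_integralB v : RT0 v ->
  dirichlet_integral D (fun x => pB D nonwet x - pB D wet x) v =
  dirichlet_integral D (pB D nonwet) v - dirichlet_integral D (pB D wet) v.
Proof.
move=> [vaff _]; rewrite /dirichlet_integral -sumrB; apply: eq_bigr => F FD.
have [a [b vE]] := vaff (owner F).
have cF : #|F| = d.+1 by move: FD => /andP[/facet_card].
apply: facet_integralB => [||t]; [exact: (pB_integrable hD)..|].
exact: (flux_facet_const _ _ cF vE).
Qed.

Lemma gravity_formB (r s : R) v : RT0 v ->
  gravity_form D (r - s) v = gravity_form D r v - gravity_form D s v.
Proof.
move=> [vaff _]; apply/eqP; rewrite eq_sym subr_eq; apply/eqP.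
have gi t i : integrable_on Omega (fun x => (t *: grad (depth D) x) 0 i).
  under eq_fun do rewrite !mxE mulrC.
  exact: (integrable_tameM M (depth_integrable hD i) (tame_cst t)).
rewrite /gravity_form -(ipvDl M) => [|i|i|i].
- by congr (ipv _ _ _); apply/funext => x; rewrite -scalerDl -mulrDl subrK.
- exact: gi.
- exact: gi.
- exact: tame_glue_affine.
Qed.

(** A left null vector y of the symmetric matrix K would satisfy (K y, y) = 0. *)
Lemma perm_unit x : Omega x -> perm D x \in unitmx.
Proof.
move=> Ox; rewrite -row_free_unit; apply: inj_row_free => y yP.
apply/eqP/negPn/negP => y0; have := perm_posdef hD Ox y0.
rewrite /mxapply -(Defs.perm_sym hD Ox) -trmx_mul trmxK yP.
by rewrite dotC dot0r ltxx.
Qed.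

(** As a function of x, 1 / lambda_t takes finitely many values, while the entries
    of the inverse permeability are integrable; hence their product is
    integrable. *)
Lemma resistanceE x : Omega x ->
  resistance D S x = (total_mobility D (Sw_h S x))^-1 *: invmx (perm D x).
Proof.
move=> Ox; rewrite /resistance invmxZ// unitmxZ ?perm_unit//.
by rewrite unitfE gt_eqF// (total_mobility_gt0 hD).
Qed.

Lemma tame_Sw (G : R -> R) : tame (Omega := Omega) (fun x => G (Sw_h S x)).
Proof.
exact: (tame_cell_at (fun o => G (if o is Some K then S wet K else 0))).
Qed.

Lemma resistance_integrable (c : R -> R) xi i : RT0 xi ->
  integrable_on Omega
    (fun x => mxapply (resistance D S x) (c (Sw_h S x) *: Defs.glue xi x) 0 i).
Proof.
move=> [xiaff _].
pose G x := \sum_j invmx (perm D x) i j *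
  ((total_mobility D (Sw_h S x))^-1 * (c (Sw_h S x) * Defs.glue xi x 0 j)).
apply: (@eq_integrable _ _ _ _ _ (measurable_domain M) (EFin \o G)).
  move=> x; rewrite inE => Ox /=; congr EFin.
  rewrite /mxapply !mxE; apply: eq_bigr => j _.
  by rewrite resistanceE// !mxE mulrCA mulrA.
apply: (integrable_on_sum M) => j.
apply: (integrable_tameM M); first exact: (perm_inv_integrable hD).
apply: tameM; first exact: (tame_Sw (fun s => (total_mobility D s)^-1)).
by apply: tameM; [exact: tame_Sw|exact: tame_glue_affine].
Qed.

Lemma frac_sum s : Defs.frac D nonwet s + Defs.frac D wet s = 1.
Proof.
rewrite /Defs.frac -mulrDl addrC divff// gt_eqF//.
exact: (total_mobility_gt0 hD).
Qed.

(** This is f_n + f_w = 1 under the integral. *)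
Lemma resistance_split xi v : RT0 xi -> RT0 v ->
  resistance_form D S (fun=> 1) xi v =
  resistance_form D S (fun x => Defs.frac D nonwet (Sw_h S x)) xi v +
  resistance_form D S (fun x => Defs.frac D wet (Sw_h S x)) xi v.
Proof.
move=> RTxi [vaff _]; rewrite /resistance_form -(ipvDl M).
- congr (ipv _ _ _); apply/funext => x.
  rewrite /mxapply -linearD/= -mulmxDr -linearD/= -scalerDl.
  by rewrite frac_sum.
- by move=> i; exact: resistance_integrable.
- by move=> i; exact: resistance_integrable.
- by move=> i; exact: tame_glue_affine.
Qed.

(** For each test field v, the wetting equation minus the equation that defines
    xi_c is the non-wetting equation: on the right, (f_n - 1) xi_c = - f_w xi_c
    and the boundary and gravity terms combine; on the left, the capillary term
    (p_c, div v) equals (p_nw, div v), since div v is an admissible test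
    function in the projection that defines p_nw. *)
Lemma darcy_equiv (pnw pw pn : Qh M) xi ut :
  pnw_eq D S pnw -> RT0 xi -> xi_eq D S xi ->
  (forall K, pn K = pnw K + pw K) ->
  darcy_wet_eq D S xi pw ut <-> darcy_nonwet_eq D S xi pn ut.
Proof.
move=> hP RTxi hC pnE.
have {pnE} -> : pn = fun K => pnw K + pw K by exact/funext.
suff H v : RT0_0 D v ->
    (resistance_form D S (fun=> 1) ut v - ip Omega (pwconst pw) (glue_div v)
    = resistance_form D S (fun x => Defs.frac D nonwet (Sw_h S x)) xi v
      - dirichlet_integral D (pB D wet) v - gravity_form D (density D wet) v) <->
    (resistance_form D S (fun=> 1) ut v
      - ip Omega (pwconst (fun K => pnw K + pw K)) (glue_div v)
    = - resistance_form D S (fun x => Defs.frac D wet (Sw_h S x)) xi v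
      - dirichlet_integral D (pB D nonwet) v - gravity_form D (density D nonwet) v).
  by split => dE v v0; apply/(H v v0)/dE.
move=> v0; have RTv := v0.1; have := hC _ v0.
have [q qE] := glue_div_pwconst RTv.1.
rewrite resistance_split// dirichlet_integralB// gravity_formB// qE -hP.
rewrite pwconstD (ipDl M); first last.
- exact: tame_pwconst.
- exact/(tame_integrable M)/tame_pwconst.
- exact/(tame_integrable M)/tame_pwconst.
by move=> ?; split => ?; lra.
Qed.

End darcy.

(** * The two saturation equations *)

Section saturations.
Context {R : realType} {d : nat} {Omega : set 'rV[R]_d.+1}.
Variables (M : mesh Omega) (D : flow_data R d.+1) (hD : flow_data_ok M D).
Local Notation point := 'rV[R]_d.+1.
Local Notation mu := (lebesgue_rV d.+1).
Implicit Types (K : cell M) (x : point) (q e : Qh M).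

(** If a relative interior point x of K also lies in K', then by conformity x is
    a convex combination of the common vertices; uniqueness of barycentric
    coordinates, all positive at x, forces every vertex of K to be common. *)
Lemma cell_at_relint K x :
  relint (@pos _ _ _ M) (verts K) x -> cell_at M x = Some K.
Proof.
move=> xK; have xKs := relint_sub_simplex xK.
have uniqK K' : cell_set K' x -> K' = K.
  move=> xK'; have : simplex (@pos _ _ _ M) (verts K :&: verts K') x.
    by rewrite -mesh_conforming.
  move=> [w [w0 w1 xw]].
  (* the weights on the common vertices, extended by zero to those of K *)
  pose w' v := if v \in verts K' then w v else 0.
  have w'E (T : nmodType) (F : R -> vertex M -> T) : (forall v, F 0 v = 0) ->
      \sum_(v in verts K) F (w' v) v = \sum_(v in verts K :&: verts K') F (w v) v.
    move=> F0; rewrite [RHS](eq_bigl (fun v => (v \in verts K) && (v \in verts K'))).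
      rewrite big_mkcondr; apply: eq_bigr => v _.
      by rewrite /w'; case: ifP.
    by move=> v; rewrite inE.
  have Kind := @verts_independent _ _ _ M K.
  have w'1 : \sum_(v in verts K) w' v = 1 by rewrite (w'E _ (fun r _ => r)).
  have xw' : x = \sum_(v in verts K) w' v *: pos v.
    by rewrite (w'E _ (fun r v => r *: pos v))// => v; rewrite scale0r.
  apply: (@verts_inj _ _ _ M); apply/esym/eqP.
  rewrite eqEcard !card_verts leqnn andbT; apply/fintype.subsetP => v vK.
  move: xK; rewrite (relintE Kind (card_verts K)) => /(_ v vK) /=.
  rewrite -(bary_unique Kind (card_verts K) w'1 xw' vK) /w'.
  by case: ifP => //; rewrite ltxx.
rewrite /cell_at; case: pickP => [K' /asboolP /uniqK -> //|/(_ K)].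
by rewrite asboolT.
Qed.

(** The domain is the interior of the union of the cells, so it contains every
    open set covered by one cell. *)
Lemma relint_sub_domain K : relint (@pos _ _ _ M) (verts K) `<=` Omega.
Proof.
rewrite [X in _ `<=` X](mesh_cover M) -open_subsetE; last first.
  exact: open_relint (@verts_independent _ _ _ M K) (card_verts K).
by move=> x /relint_sub_simplex xK; exists K.
Qed.

Lemma tame_porosity : tame (Omega := Omega) (porosity D).
Proof.
split; first exact: (porosity_measurable hD).
have [c [C [c0 cC]]] := porosity_bounds hD; exists C => x /cC /andP[cx xC].
by rewrite ger0_norm// (le_trans (ltW c0)).
Qed.

Lemma tame_mass_rate e (dt : R) :
  tame (Omega := Omega) (fun x => porosity D x * (pwconst e x / dt)).
Proof.
apply: tameM; first exact: tame_porosity.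
by apply: tameM; [exact: tame_pwconst|exact: tame_cst].
Qed.

(** Tested against e itself, the weighted mass form is the integral of
    phi e^2 / dt, which is nonnegative and bounded below by a positive constant
    on the interior of any cell where e does not vanish; this interior has
    positive measure. *)
Lemma mass_rate_eq0 e (dt : R) : 0 < dt ->
  ip Omega (fun x => porosity D x * (pwconst e x / dt)) (pwconst e) = 0 ->
  forall K, e K = 0.
Proof.
move=> dt0 ip0 K; apply/eqP/negPn/negP => eK0.
have [c [C [c0 cC]]] := porosity_bounds hD.
pose f x := porosity D x * (pwconst e x / dt) * pwconst e x.
have fE x : f x = porosity D x * (pwconst e x ^+ 2 / dt) by rewrite /f; ring.
have tf : tame (Omega := Omega) f.
  by apply: tameM; [exact: tame_mass_rate|exact: tame_pwconst].
have f_ge0 x : Omega x -> 0 <= f x.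
  move=> /cC /andP[cx _]; rewrite fE mulr_ge0 ?divr_ge0 ?sqr_ge0 ?(ltW dt0)//.
  exact: le_trans (ltW c0) cx.
pose A := relint (@pos _ _ _ M) (verts K).
have oA : open A := open_relint (@verts_independent _ _ _ M K) (card_verts K).
have mA : measurable A by exact: open_measurable_rV.
have AO : A `<=` Omega by exact: relint_sub_domain.
have mO : measurable Omega := measurable_domain M.
have mf : measurable_fun Omega (EFin \o f).
  by apply/measurable_EFinP; case: tf.
pose m := c * (e K ^+ 2 / dt).
have m0 : 0 < m by rewrite mulr_gt0// divr_gt0// exprn_even_gt0.
have intf : (\int[mu]_(x in Omega) (f x)%:E = 0)%E.
  have fin : (\int[mu]_(x in Omega) (f x)%:E)%E \is a fin_num.
    exact: (integrable_fin_num mO (tame_integrable M tf)).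
  by rewrite -(fineK fin); congr EFin.
have : (m%:E * mu A <= \int[mu]_(x in Omega) (f x)%:E)%E.
  rewrite -integral_cst//.
  apply: (@le_trans _ _ (\int[mu]_(x in A) (f x)%:E)%E).
    apply: ge0_le_integral => //.
    - by move=> x _; rewrite lee_fin ltW.
    - exact: measurable_funS mf.
    - move=> x Ax; rewrite lee_fin fE /pwconst /Defs.glue (cell_at_relint Ax).
      rewrite /m ler_wpM2r ?divr_ge0 ?sqr_ge0 ?(ltW dt0)//.
      by have /andP[] := cC _ (AO x Ax).
  apply: ge0_subset_integral => // x /f_ge0; by rewrite lee_fin.
have [y Ay] := relint_neq0 (@pos _ _ _ M) (card_verts K).
by rewrite intf leNgt mule_gt0// (open_lebesgue_gt0 oA Ay).
Qed.

Section update.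
Variables (tn tn1 : R) (S : phase -> Qh M) (u : phase -> broken M point).
Hypotheses (htn : tn < tn1) (hS : forall K, S wet K + S nonwet K = 1).
Variables (ut xi : broken M point).
Hypothesis ut_total : total_eq D S u ut.

(** Adding the two mass equations cancels the capillary fluxes, which enter with
    opposite signs, and the total velocity equation removes the convective
    fluxes against the sources. What remains is the mass form of the defect
    S_w + S_n - 1, because the old saturations sum to 1. *)
Lemma mass_nonwet_equiv Sw1 Sn1 : mass_eq D tn tn1 S u wet ut xi Sw1 ->
  mass_eq D tn tn1 S u nonwet ut xi Sn1 <->
  forall q, ip Omega (fun x => porosity D x *
    (pwconst (fun K => Sw1 K + Sn1 K - 1) x / (tn1 - tn))) (pwconst q) = 0.
Proof.
move=> mw.
have rateE q : ip Omega (fun x => porosity D x *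
      (pwconst (fun K => Sw1 K + Sn1 K - 1) x / (tn1 - tn))) (pwconst q) =
    ip Omega (fun x => porosity D x *
      ((pwconst Sw1 x - pwconst (S wet) x) / (tn1 - tn))) (pwconst q) +
    ip Omega (fun x => porosity D x *
      ((pwconst Sn1 x - pwconst (S nonwet) x) / (tn1 - tn))) (pwconst q).
  have rate_tame (T : Qh M) a : tame (Omega := Omega) (fun x => porosity D x *
      ((pwconst T x - pwconst (S a) x) / (tn1 - tn))).
    have -> : (fun x => porosity D x * ((pwconst T x - pwconst (S a) x) / (tn1 - tn))) =
        fun x => porosity D x * (pwconst (fun K => T K - S a K) x / (tn1 - tn)).
      apply/funext => x; congr (_ * (_ / _)); rewrite /pwconst /Defs.glue.
      by case: cell_at => //; rewrite subrr.
    exact: tame_mass_rate.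
  rewrite -(ipDl M); first last.
  - exact: tame_pwconst.
  - exact: (tame_integrable M (rate_tame _ _)).
  - exact: (tame_integrable M (rate_tame _ _)).
  apply: ip_eq => x _; congr (_ * _); rewrite -mulrDr -mulrDl.
  congr (_ * (_ / _)); rewrite /pwconst /Defs.glue; case: cell_at => [K|].
    by rewrite -(hS K); ring.
  by rewrite !subrr addr0.
have sourceE q : ip Omega (total_source D) (pwconst q) =
    ip Omega (source D wet) (pwconst q) + ip Omega (source D nonwet) (pwconst q).
  rewrite -(ipDl M)//; try exact: (source_integrable hD).
  exact: tame_pwconst.
split => [mn q|e0 q].
  rewrite rateE; have := mw q; have := mn q; have := ut_total q.
  by rewrite sourceE /sign; lra.
have := e0 q; rewrite rateE; have := mw q; have := ut_total q.
by rewrite sourceE /sign; lra.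
Qed.

Lemma mass_complement Sw1 : mass_eq D tn tn1 S u wet ut xi Sw1 ->
  mass_eq D tn tn1 S u nonwet ut xi (fun K => 1 - Sw1 K).
Proof.
move=> mw; apply/(mass_nonwet_equiv _ mw) => q.
rewrite /ip; under eq_Rintegral => x _.
  have -> : pwconst (fun K => Sw1 K + (1 - Sw1 K) - 1) x = 0.
    rewrite /pwconst /Defs.glue; case: cell_at => // K; ring.
  rewrite mul0r mulr0 mul0r; over.
by rewrite Rintegral_cst ?mul0r//; exact: (measurable_domain M).
Qed.

Lemma mass_sum Sw1 Sn1 : mass_eq D tn tn1 S u wet ut xi Sw1 ->
  mass_eq D tn tn1 S u nonwet ut xi Sn1 -> forall K, Sw1 K + Sn1 K = 1.
Proof.
move=> mw /(mass_nonwet_equiv _ mw) e0 K; apply/eqP; rewrite -subr_eq0; apply/eqP.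
by apply: (mass_rate_eq0 (e := fun K => _) _ (e0 _)); rewrite subr_gt0.
Qed.

End update.
End saturations.

(** * Symmetry of the scheme in the two phases *)

Theorem mainTheorem3 (R : realType) (d : nat)
  (hd : (d.+1 = 2 \/ d.+1 = 3)%N)
  (Omega : set 'rV[R]_d.+1) (M : mesh Omega)
  (c : R) (hqu : quasi_uniform M c)
  (D : flow_data R d.+1) (hD : flow_data_ok M D)
  (tn tn1 : R) (htn : tn < tn1)
  (S : phase -> Qh M) (hS : forall K, S wet K + S nonwet K = 1)
  (u : phase -> broken M 'rV[R]_d.+1)
  (pnw : Qh M) (xi : broken M 'rV[R]_d.+1)
  (hP : pnw_eq D S pnw) (hxi : RT0 xi) (hC : xi_eq D S xi) :
  (forall (pw pn : Qh M) (ut : broken M 'rV[R]_d.+1),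
     [/\ RT0 ut, total_eq D S u ut, darcy_wet_eq D S xi pw ut &
         forall K, pn K = pnw K + pw K]
     <->
     [/\ RT0 ut, total_eq D S u ut, darcy_nonwet_eq D S xi pn ut &
         forall K, pw K = pn K - pnw K])
  /\
  (forall ut : broken M 'rV[R]_d.+1, RT0 ut -> total_eq D S u ut ->
     (forall Sw1 Sn1 : Qh M,
        (mass_eq D tn tn1 S u wet ut xi Sw1 /\ forall K, Sn1 K = 1 - Sw1 K)
        <->
        (mass_eq D tn tn1 S u wet ut xi Sw1 /\ mass_eq D tn tn1 S u nonwet ut xi Sn1))
     /\
     (forall Sw1 Sn1 : Qh M,
        mass_eq D tn tn1 S u wet ut xi Sw1 ->
        mass_eq D tn tn1 S u nonwet ut xi Sn1 ->
        forall K, Sw1 K + Sn1 K = 1)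
     /\
     (forall Sw1 : Qh M,
        mass_eq D tn tn1 S u wet ut xi Sw1 ->
        mass_eq D tn tn1 S u nonwet ut xi (fun K => 1 - Sw1 K))).
Proof.
split=> [pw pn ut|ut _ ut_total]; split.
- move=> [RTut ut_total dw pnE]; split=> // [|K]; last first.
    by rewrite pnE [pnw K + _]addrC addrK.
  by apply/(darcy_equiv hD _ hP hxi hC pnE).
- move=> [RTut ut_total dn pwE].
  have pnE K : pn K = pnw K + pw K by rewrite pwE addrC subrK.
  by split=> //; apply/(darcy_equiv hD _ hP hxi hC pnE).
- move=> Sw1 Sn1; split => -[mw].
    move=> Sn1E; split => //.
    have -> : Sn1 = fun K => 1 - Sw1 K by exact/funext.
    exact: mass_complement.
  move=> mn; split => // K.
  by rewrite -(mass_sum hD htn hS ut_total mw mn K) addrC addKr.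
- split=> [Sw1 Sn1 mw mn|Sw1 mw].
    exact: (mass_sum hD htn hS ut_total mw mn).
  exact: mass_complement.
Qed.
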